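(* Suppose that $R$ is a right strongly exchange ring with countably many idempotents. Then $R$ is semiperfect.
   Context: Rings are associative with identity. A right coprime pair in $R$ is a pair of elements $a,b\in R$ with $aR+bR=R$. Two right coprime pairs $(a,b)$, $(a',b')$ are identified when $aR=a'R$ and $bR=b'R$; $\langle a,b\rangle$ denotes the equivalence class, $\mathrm{RCP}(R)$ the set of all classes, and a pair $(a',b')$ with $\langle a',b'\rangle=\langle a,b\rangle$ is called a pair of generators of $\langle a,b\rangle$. $\mathrm{RCP}(R)$ is partially ordered by $\langle a,b\rangle\le\langle a',b'\rangle$ iff $aR\subseteq a'R$ and $bR\subseteq b'R$. A compatible descending chain of right coprime pairs is a family $\{p_\alpha\mid\alpha<\kappa\}\subseteq \mathrm{RCP}(R)$ ($\kappa$ an ordinal, $p_\beta\le p_\alpha$ for $\alpha<\beta<\kappa$) such that there exist a pair of generators $(a_\alpha,b_\alpha)$ of $p_\alpha$ for each $\alpha<\kappa$, and elements $r_{\alpha\beta},s_{\alpha\beta}\in R$ for $\alpha<\beta<\kappa$, with $a_\beta=a_\alpha r_{\alpha\beta}$ and $b_\beta=b_\alpha s_{\alpha\beta}$ for all $\alpha<\beta<\kappa$, and $r_{\alpha\beta}=r_{\alpha\gamma}r_{\gamma\beta}$, $s_{\alpha\beta}=s_{\alpha\gamma}s_{\gamma\beta}$ for all $\alpha<\gamma<\beta<\kappa$. A minimal lower bound of a chain is a lower bound of the chain in $\mathrm{RCP}(R)$ that is a minimal element of the poset $\mathrm{RCP}(R)$. The ring $R$ is right strongly exchange if every compatible descending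 chain of right coprime pairs of $R$ has a minimal lower bound. *)

(* Defs.v *)
From HB Require Import structures.
From mathcomp Require Import all_boot all_order all_algebra.
From mathcomp Require Import generic_quotient ring_quotient.
From mathcomp Require Import all_classical.
From mathcomp Require wochoice.

Set Implicit Arguments.
Unset Strict Implicit.
Unset Printing Implicit Defensive.

Import Order.TTheory GRing.Theory.

Local Open Scope classical_set_scope.
Local Open Scope ring_scope.
Local Open Scope quotient_scope.

(* Rings are [pzRingType]s: associative, with 1, the zero ring being allowed. *)

Section RightIdeals.
Variable R : pzRingType.
Implicit Types I K M : set R.

Definition right_ideal I :=
  [/\ I 0, forall x y, I x -> I y -> I (x - y) & forall x r, I x -> I (x * r)].

Definition maximal_right_ideal M :=
  [/\ right_ideal M, M <> setT &
      forall I, right_ideal I -> M `<=` I -> I = M \/ I = setT].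

Definition rprincipal (a : R) : set R := [set a * r | r in setT].

Definition ideal_sum I K : set R := [set x + y | x in I & y in K].

(* Semisimplicity of the right regular module: every submodule of R_R is a
   direct summand. This is the usual "semisimple (Artinian) ring". *)
Definition semisimple_ring :=
  forall I, right_ideal I ->
    exists K, [/\ right_ideal K, ideal_sum I K = setT & I `&` K = [set 0]].

End RightIdeals.

Section Jacobson.
Variable R : pzRingType.

(* J(R), the intersection of the maximal right ideals (all of R if R = 0). *)
Definition jacobson : R -> bool :=
  fun x => `[< forall M : set R, maximal_right_ideal M -> M x >].

Lemma jacobsonP x :
  reflect (forall M : set R, maximal_right_ideal M -> M x) (x \in jacobson).
Proof. exact: asboolP. Qed.

Lemma jacobson_zmod_closed : zmod_closed jacobson.
Proof.
split=> [|x y /jacobsonP Jx /jacobsonP Jy]; apply/jacobsonP => M mM.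
  by case: (mM) => -[].
by case: (mM) => -[_ MB _] _ _; apply: MB; [apply: Jx|apply: Jy].
Qed.

HB.instance Definition _ := GRing.isZmodClosed.Build R jacobson
  jacobson_zmod_closed.

Lemma jacobsonMr x r : x \in jacobson -> x * r \in jacobson.
Proof.
move=> /jacobsonP Jx; apply/jacobsonP => M mM.
by case: (mM) => -[_ _ MM] _ _; apply: MM; apply: Jx.
Qed.

Lemma jacobsonMl x r : x \in jacobson -> r * x \in jacobson.
Proof.
move=> /jacobsonP Jx; apply/jacobsonP => M mM.
case: (mM) => -[M0 MB MM] MT Mmax.
have MD u v : M u -> M v -> M (u + v).
  by move=> Mu Mv; rewrite -[v]opprK; apply: (MB) => //; rewrite -[- v]sub0r; apply: MB.
have [Mr|nMr] := pselect (M r); first exact: MM.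
pose N := [set y | M (r * y)].
suff mN : maximal_right_ideal N by apply: (Jx N mN).
split.
- split=> [|u v|u v]; rewrite /N /= ?mulr0 ?mulrBr ?mulrA //.
  + exact: MB.
  + exact: MM.
- move=> NT; have : N 1 by rewrite NT.
  by rewrite /N /= mulr1; exact: nMr.
move=> I [I0 IB IM] NI.
have ID u v : I u -> I v -> I (u + v).
  by move=> Iu Iv; rewrite -[v]opprK; apply: (IB) => //; rewrite -[- v]sub0r; apply: IB.
have [IN|/existsNP [y /not_implyP [Iy nNy]]] := pselect (I `<=` N).
  by left; apply/seteqP.
right; apply/seteqP; split=> // z _.
pose L := ideal_sum M (rprincipal (r * y)).
have LT : L = setT.
  have [] // := Mmax L.
  - split.
    + by exists 0 => //; exists 0; [exists 0; rewrite ?mulr0|rewrite addr0].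
    + move=> _ _ [u Mu [_ [s _ <-] <-]] [v Mv [_ [t _ <-] <-]].
      exists (u - v); first exact: MB.
      by exists (r * y * (s - t)); [exists (s - t)|rewrite mulrBr opprD addrACA].
    + move=> _ w [u Mu [_ [s _ <-] <-]].
      exists (u * w); first exact: MM.
      by exists (r * y * (s * w)); [exists (s * w)|rewrite mulrDl -!mulrA].
  - move=> u Mu; exists u => //; exists 0; last by rewrite addr0.
    by exists 0; rewrite ?mulr0.
  - move=> LM; case: nNy; rewrite /N /= -LM.
    exists 0 => //; exists (r * y); last by rewrite add0r.
    by exists 1; rewrite ?mulr1.
have : L (r * z) by rewrite LT.
case=> u Mu [_ [s _ <-] E].
rewrite -(subrK (y * s) z); apply: ID; last exact: IM.
by apply: NI; rewrite /N /= mulrBr -E mulrA addrK.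
Qed.

(* The library equips {ideal_quot I} with a product only over commutative rings. *)
Definition jacobson_zmod : zmodClosed R := GRing.ZmodClosed.clone R jacobson _.

Definition jacobson_quot := {ideal_quot jacobson_zmod}.

HB.instance Definition _ := GRing.Zmodule.on jacobson_quot.
HB.instance Definition _ : EqQuotient R (Quotient.equiv jacobson_zmod) jacobson_quot :=
  EqQuotient.on jacobson_quot.
HB.instance Definition _ := ZmodQuotient.on jacobson_quot.

Definition jacobson_one : jacobson_quot := lift_cst jacobson_quot 1.
Definition jacobson_mul := lift_op2 jacobson_quot *%R.

Canonical pi_jacobson_one_morph := PiConst jacobson_one.

Lemma pi_jacobson_mul :
  {morph \pi_jacobson_quot : x y / x * y >-> jacobson_mul x y}.
Proof.
move=> x y; unlock jacobson_mul; apply/eqP; rewrite piE Quotient.equivE.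
rewrite -[_ * _](addrNK (x * repr (\pi_jacobson_quot y))) -mulrBr.
rewrite -addrA -mulrBl rpredD //.
  by apply: jacobsonMl; rewrite Quotient.idealrDE opprK reprK.
by apply: jacobsonMr; rewrite Quotient.idealrDE opprK reprK.
Qed.
Canonical pi_jacobson_mul_morph := PiMorph2 pi_jacobson_mul.

Fact jacobson_mulA : associative jacobson_mul.
Proof. by move=> x y z; rewrite -[x]reprK -[y]reprK -[z]reprK !piE mulrA. Qed.

Fact jacobson_mul1 : left_id jacobson_one jacobson_mul.
Proof. by move=> x; rewrite -[x]reprK !piE mul1r. Qed.

Fact jacobson_mulr1 : right_id jacobson_one jacobson_mul.
Proof. by move=> x; rewrite -[x]reprK !piE mulr1. Qed.

Fact jacobson_mulDl : left_distributive jacobson_mul +%R.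
Proof.
move=> x y z; rewrite -[x]reprK -[y]reprK -[z]reprK.
by rewrite !piE /= mulrDl.
Qed.

Fact jacobson_mulDr : right_distributive jacobson_mul +%R.
Proof.
move=> x y z; rewrite -[x]reprK -[y]reprK -[z]reprK.
by rewrite !piE /= mulrDr.
Qed.

HB.instance Definition _ := GRing.Zmodule_isPzRing.Build jacobson_quot
  jacobson_mulA jacobson_mul1 jacobson_mulr1 jacobson_mulDl jacobson_mulDr.

Definition jacobson_proj (x : R) : jacobson_quot := \pi_jacobson_quot x.

Fact jacobson_proj_zmod_morphism : zmod_morphism jacobson_proj.
Proof. by move=> x y; rewrite /jacobson_proj !piE. Qed.
HB.instance Definition _ := GRing.isZmodMorphism.Build R jacobson_quot
  jacobson_proj jacobson_proj_zmod_morphism.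

Fact jacobson_proj_monoid_morphism : monoid_morphism jacobson_proj.
Proof. by split=> [|x y]; rewrite /jacobson_proj !piE. Qed.
HB.instance Definition _ := GRing.isMonoidMorphism.Build R jacobson_quot
  jacobson_proj jacobson_proj_monoid_morphism.

Lemma jacobson_proj_surj (u : jacobson_quot) : exists x, jacobson_proj x = u.
Proof. by exists (repr u); rewrite /jacobson_proj reprK. Qed.

Lemma jacobson_proj_eq0 x : (jacobson_proj x == 0) = (x \in jacobson).
Proof.
by rewrite -(rmorph0 jacobson_proj) /jacobson_proj -Quotient.idealrBE subr0.
Qed.

End Jacobson.

Definition idempotent_elt (R : pzRingType) (e : R) := e * e = e.

Definition idempotents_lift_mod_jacobson (R : pzRingType) :=
  forall u : jacobson_quot R, idempotent_elt u ->
    exists e : R, idempotent_elt e /\ jacobson_proj e = u.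

Definition semiperfect (R : pzRingType) :=
  semisimple_ring (jacobson_quot R) /\ idempotents_lift_mod_jacobson R.

Section RightCoprimePairs.
Variable R : pzRingType.

Definition right_coprime (a b : R) :=
  ideal_sum (rprincipal a) (rprincipal b) = setT.

Definition rcpair := {ab : R * R | `[< right_coprime ab.1 ab.2 >]}.

Definition rcpair_eq (u v : rcpair) : bool :=
  `[< rprincipal (val u).1 = rprincipal (val v).1 /\
      rprincipal (val u).2 = rprincipal (val v).2 >].

Fact rcpair_eq_equiv : equiv_class_of rcpair_eq.
Proof.
split=> [u|u v|v u w]; first exact/asboolP.
- by apply/asboolP/asboolP => -[E1 E2].
- move=> /asboolP[E1 E2] /asboolP[F1 F2]; apply/asboolP.
  by rewrite E1 E2 F1 F2.
Qed.

Canonical rcpair_equiv := EquivRelPack rcpair_eq_equiv.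
Canonical rcpair_encModRel := defaultEncModRel rcpair_eq.

Definition RCP := {eq_quot rcpair_eq}.

HB.instance Definition _ := Choice.on RCP.
HB.instance Definition _ : EqQuotient rcpair rcpair_eq RCP := EqQuotient.on RCP.

Definition rcp_class (a b : R) (ab : right_coprime a b) : RCP :=
  \pi_RCP (exist (fun cd : R * R => `[< right_coprime cd.1 cd.2 >])
             (a, b) (asboolT ab)).

Definition generators (p : RCP) (a b : R) :=
  exists ab : right_coprime a b, rcp_class ab = p.

(* Computed on representatives; [rcp_leE] shows that the choice is immaterial. *)
Definition rcp_le (p q : RCP) : bool :=
  `[< rprincipal (val (repr p)).1 `<=` rprincipal (val (repr q)).1 /\
      rprincipal (val (repr p)).2 `<=` rprincipal (val (repr q)).2 >].

Fact rcp_le_refl : reflexive rcp_le.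
Proof. by move=> p; apply/asboolP; split. Qed.

Fact rcp_le_anti : antisymmetric rcp_le.
Proof.
move=> p q /andP[/asboolP[pq1 pq2] /asboolP[qp1 qp2]].
rewrite -[p]reprK -[q]reprK; apply/eqP; rewrite piE.
by apply/asboolP; split; apply/seteqP; split.
Qed.

Fact rcp_le_trans : transitive rcp_le.
Proof.
move=> q p r /asboolP[pq1 pq2] /asboolP[qr1 qr2].
apply/asboolP; split; first exact: subset_trans qr1.
exact: subset_trans qr2.
Qed.

Fact rcp_display : Order.disp_t. Proof. exact: Order.Disp tt tt. Qed.

HB.instance Definition _ := Order.Le_isPOrder.Build rcp_display RCP
  rcp_le_refl rcp_le_anti rcp_le_trans.

Lemma repr_rcp_class (a b : R) (ab : right_coprime a b) :
  rprincipal (val (repr (rcp_class ab))).1 = rprincipal a /\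
  rprincipal (val (repr (rcp_class ab))).2 = rprincipal b.
Proof.
suff : rcpair_eq (repr (rcp_class ab))
         (exist (fun cd : R * R => `[< right_coprime cd.1 cd.2 >])
             (a, b) (asboolT ab)) by move/asboolP.
by have /eqP := reprK (rcp_class ab); rewrite {2}/rcp_class piE.
Qed.

Lemma rcp_leE (a b c d : R) (ab : right_coprime a b) (cd : right_coprime c d) :
  (rcp_class ab <= rcp_class cd)%O =
    `[< rprincipal a `<=` rprincipal c /\ rprincipal b `<=` rprincipal d >].
Proof.
rewrite /Order.le /= /rcp_le.
by have [-> ->] := repr_rcp_class ab; have [-> ->] := repr_rcp_class cd.
Qed.

Lemma rcp_class_eqE (a b c d : R)
    (ab : right_coprime a b) (cd : right_coprime c d) :
  rcp_class ab = rcp_class cd <->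
  rprincipal a = rprincipal c /\ rprincipal b = rprincipal d.
Proof.
split=> [E|E]; last by apply/eqP; rewrite piE; apply/asboolP.
have [<- <-] := repr_rcp_class ab.
by have [<- <-] := repr_rcp_class cd; rewrite E.
Qed.

(* The ordinal kappa is rendered by an arbitrary well-ordered type. *)
Definition compatible_descending_chain (d : Order.disp_t) (kappa : orderType d)
    (p : kappa -> RCP) :=
  [/\ wochoice.well_order (<=%O : rel kappa),
      forall i j, (i < j)%O -> (p j <= p i)%O &
      exists (a b : kappa -> R) (r s : kappa -> kappa -> R),
        [/\ forall i, generators (p i) (a i) (b i),
            forall i j, (i < j)%O -> a j = a i * r i j /\ b j = b i * s i j &
            forall i k j, (i < k)%O -> (k < j)%O ->
              r i j = r i k * r k j /\ s i j = s i k * s k j]].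

(* A minimal lower bound is minimal in the whole poset RCP(R), not merely among
   the lower bounds. *)
Definition minimal_lower_bound (d : Order.disp_t) (kappa : orderType d)
    (p : kappa -> RCP) (q : RCP) :=
  (forall i, (q <= p i)%O) /\ (forall q' : RCP, (q' <= q)%O -> q' = q).

Definition right_strongly_exchange :=
  forall (d : Order.disp_t) (kappa : orderType d) (p : kappa -> RCP),
    compatible_descending_chain p -> exists q, minimal_lower_bound p q.

End RightCoprimePairs.

(* Main.v *)
(** By modularity, [⟨e, 1 - e⟩] with [e] idempotent is a minimal coprime pair. The
    point is the converse: let [⟨a, b⟩] be minimal, with [a + b = 1] as we may
    assume. Then [b = b^2 s] for some [s], since [⟨a, b^2⟩] is coprime; [y = 1 - b s]
    is killed by [b], hence lies in [aR], and [⟨y, b⟩] is coprime, so [aR = yR] by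
    minimality and [ba = 0], i.e. [a] is idempotent. Constant chains now show that
    [R] is an exchange ring, so idempotents lift modulo the Jacobson radical. An
    infinite orthogonal family [(e_n)] of nonzero idempotents is impossible: for
    each [S], the chain with entries [1 - Σ_{i < n, i ∈ S} e_i] and
    [1 - Σ_{i < n, i ∉ S} e_i] yields an idempotent [c] with [e_i c = 0] for
    [i ∈ S] and [e_i c = e_i] otherwise, so a diagonal argument contradicts
    countability. Hence every right ideal [I] contains an idempotent [e] such that
    [I ∩ (1 - e)R] has no nonzero idempotent; by exchange this intersection lies in
    the radical, so [I = eR] modulo the radical. *)
Require Import Defs.
From mathcomp Require Import all_boot all_order all_algebra.
From mathcomp Require Import all_classical.

Import Order.TTheory GRing.Theory.

Local Open Scope classical_set_scope.
Local Open Scope ring_scope.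

(** * Coprime pairs and the idempotents below minimal ones *)

Lemma right_coprimeP (R : pzRingType) (a b : R) :
  right_coprime a b <-> exists x y, a * x + b * y = 1.
Proof.
split=> [ab|[x [y xy]]].
  have : ideal_sum (rprincipal a) (rprincipal b) 1 by rewrite ab.
  by move=> [_ [x _ <-] [_ [y _ <-] xy]]; exists x, y.
apply/seteqP; split=> // z _.
exists (a * x * z); first by exists (x * z); rewrite ?mulrA.
exists (b * y * z); first by exists (y * z); rewrite ?mulrA.
by rewrite -mulrDl xy mul1r.
Qed.

Lemma rprincipal_subP (R : pzRingType) (a b : R) :
  rprincipal a `<=` rprincipal b <-> rprincipal b a.
Proof.
split=> [ab|[r _ <-] _ [s _ <-]]; last by exists (r * s); rewrite ?mulrA.
by apply: ab; exists 1; rewrite ?mulr1.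
Qed.

Lemma rcp_classP (R : pzRingType) (q : RCP R) :
  exists (a b : R) (ab : right_coprime a b), q = rcp_class ab.
Proof.
rewrite -[q]generic_quotient.reprK; case: (generic_quotient.repr q) => [[a b] /= h].
exists a, b, (asboolW h); rewrite /rcp_class.
by congr generic_quotient.pi; apply/val_inj.
Qed.

Lemma minimal_pair_idempotent (R : pzRingType) (a b : R) :
  right_coprime a b ->
  (forall c d, right_coprime c d -> rprincipal a c -> rprincipal b d ->
     rprincipal c a /\ rprincipal d b) ->
  exists e, [/\ idempotent_elt e, rprincipal a e & rprincipal b (1 - e)].
Proof.
move=> /right_coprimeP[x [y xy]] ab_min.
set a1 := a * x in xy; set b1 := b * y in xy.
(* Minimality passes to [(a1, b1)], whose entries sum to 1. *)
have min1 c d : right_coprime c d -> rprincipal a1 c -> rprincipal b1 d ->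
    rprincipal c a1 /\ rprincipal d b1.
  move=> cd [u _ cE] [v _ dE].
  have [||[w _ wE] [z _ zE]] := ab_min _ _ cd.
  - by exists (x * u); rewrite ?mulrA.
  - by exists (y * v); rewrite ?mulrA.
  - by split; [exists (w * x)|exists (z * y)]; rewrite // mulrA ?wE ?zE.
have [|||_ [s _ sE]] := min1 a1 (b1 * b1).
(* [a1 * (1 + b1) + b1 * b1 = a1 + (a1 + b1) * b1 = 1]. *)
- apply/right_coprimeP; exists (1 + b1), 1.
  by rewrite mulr1 mulrDr mulr1 -addrA -mulrDl xy mul1r.
- by exists 1; rewrite ?mulr1.
- by exists b1.
pose z := 1 - b1 * s.
have bz0 : b1 * z = 0 by rewrite mulrBr mulr1 mulrA sE subrr.
have az : a1 * z = z by rewrite -[RHS]mul1r -xy mulrDl bz0 addr0.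
have [|||[w _ wE] _] := min1 z b1.
- by apply/right_coprimeP; exists 1, s; rewrite mulr1 subrK.
- by exists z.
- by exists 1; rewrite ?mulr1.
exists a1; split; last 2 first.
- by exists x.
- by exists y => //; rewrite -xy addrC addKr.
have ba0 : b1 * a1 = 0 by rewrite -wE mulrA bz0 mul0r.
by rewrite /idempotent_elt -[RHS]mul1r -xy mulrDl ba0 addr0.
Qed.

Lemma well_order_nat : wochoice.well_order (<=%O : rel nat).
Proof.
apply: wochoice.antisymmetric_well_order; first exact: le_anti.
move=> A [n An].
have [m Am m_min] := ex_minnP (ex_intro (fun n => n \in A) n An).
by exists m; split=> // k; apply: m_min.
Qed.

(** * The exchange property and the Jacobson radical *)

Section StronglyExchange.
Variable R : pzRingType.
Hypothesis Rexchange : right_strongly_exchange R.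

(** A minimal lower bound of the chain is minimal among all coprime pairs, so
    [minimal_pair_idempotent] applies to it. *)
Lemma chain_idempotent (a b : nat -> R) (r s : nat -> nat -> R) :
  (forall n, right_coprime (a n) (b n)) ->
  (forall i j, (i < j)%N -> a j = a i * r i j /\ b j = b i * s i j) ->
  (forall i k j, (i < k)%N -> (k < j)%N ->
     r i j = r i k * r k j /\ s i j = s i k * s k j) ->
  exists e, idempotent_elt e /\
    forall n, rprincipal (a n) e /\ rprincipal (b n) (1 - e).
Proof.
move=> ab abS rsM.
have [|q [q_le q_min]] := Rexchange _ _ (fun n : nat => rcp_class (ab n)).
  split; first exact: well_order_nat.
  - move=> i j ij; have [aE bE] := abS _ _ ij.
    rewrite rcp_leE; apply/asboolP; split; apply/rprincipal_subP.
      by rewrite aE; exists (r i j).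
    by rewrite bE; exists (s i j).
  - by exists a, b, r, s; split=> // i; exists (ab i).
have [c [d [cd qE]]] := rcp_classP R q.
have [f g fg cf dg|e [ee [u _ uE] [v _ vE]]] := minimal_pair_idempotent R c d cd.
  have /q_min : (rcp_class fg <= q)%O.
    by rewrite qE rcp_leE; apply/asboolP; split; apply/rprincipal_subP.
  rewrite qE => /rcp_class_eqE[Ef Eg].
  by split; apply/rprincipal_subP; rewrite ?Ef ?Eg.
exists e; split=> // n.
have := q_le n; rewrite qE rcp_leE => /asboolP[ca db].
split; first by apply: ca; exists u.
by apply: db; exists v.
Qed.

Lemma exchange_idempotent (x : R) :
  exists e, [/\ idempotent_elt e, rprincipal x e & rprincipal (1 - x) (1 - e)].
Proof.
have [|||e [ee /(_ 0%N)[xe xe']]] := chain_idempotent (fun _ => x)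
  (fun _ => 1 - x) (fun _ _ => 1) (fun _ _ => 1).
- by move=> _; apply/right_coprimeP; exists 1, 1; rewrite !mulr1 addrC subrK.
- by move=> *; rewrite !mulr1.
- by move=> *; rewrite !mulr1.
by exists e.
Qed.

(** The exchange idempotent [e] of any preimage [x] is a lift: modulo the radical, [x * e = e] and
    [x * (1 - e) = 0]. *)
Lemma idempotents_lift : idempotents_lift_mod_jacobson R.
Proof.
move=> u uu; have [x xu] := jacobson_proj_surj u; rewrite -{}xu in uu *.
have [e [ee [r _ rE] [s _ sE]]] := exchange_idempotent x.
exists e; split=> //.
have xe : jacobson_proj x * jacobson_proj e = jacobson_proj e.
  by rewrite -rE rmorphM mulrA uu.
rewrite -[LHS]xe; apply/eqP; rewrite eq_sym -subr_eq0 -[X in X - _]mulr1 -mulrBr.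
rewrite -(rmorph1 (@jacobson_proj R)) -rmorphB -sE rmorphM mulrA rmorphB rmorph1.
by rewrite mulrBr mulr1 uu subrr mul0r.
Qed.

(** If a maximal [M] misses [x], then [1 = m + x * t] with [m] in [M]. The exchange idempotent of
    [x * t] lies in [xR], so it is 0 and 1 lies in [(1 - x * t)R = mR]. *)
Lemma no_idempotent_jacobson (x : R) :
  (forall f, idempotent_elt f -> rprincipal x f -> f = 0) -> x \in @jacobson R.
Proof.
move=> x_idem; apply/jacobsonP => M [[M0 MB MM] MT Mmax].
have MD u v : M u -> M v -> M (u + v).
  by move=> Mu Mv; rewrite -[v]opprK; apply: (MB) => //; rewrite -[- v]sub0r; apply: MB.
apply: contrapT => nMx; apply: MT; apply/seteqP; split=> // z _.
rewrite -[z]mul1r; apply: (MM).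
pose L := ideal_sum M (rprincipal x).
have [|w Mw||LT] := Mmax L.
- split.
  + by exists 0 => //; exists 0; [exists 0; rewrite ?mulr0|rewrite addr0].
  + move=> _ _ [u Mu [_ [s _ <-] <-]] [v Mv [_ [t _ <-] <-]].
    exists (u - v); first exact: MB.
    by exists (x * (s - t)); [exists (s - t)|rewrite mulrBr opprD addrACA].
  + move=> _ w [u Mu [_ [s _ <-] <-]].
    exists (u * w); first exact: MM.
    by exists (x * (s * w)); [exists (s * w)|rewrite mulrDl -!mulrA].
- by exists w => //; exists 0; [exists 0; rewrite ?mulr0|rewrite addr0].
- move=> LM; case: nMx; rewrite -LM.
  by exists 0 => //; exists x; [exists 1; rewrite ?mulr1|rewrite add0r].
have : L 1 by rewrite LT.
move=> [m Mm [_ [t _ <-] mE]].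
have [f [ff [u _ uE] [v _ vE]]] := exchange_idempotent (x * t).
have f0 : f = 0.
  by apply: x_idem => //; exists (t * u); rewrite // mulrA.
rewrite f0 subr0 in vE.
by rewrite -vE -mE addrK; apply: MM.
Qed.

(** * Orthogonal sequences of idempotents *)

Section OrthogonalSequence.
Variable e : nat -> R.
Hypothesis ee : forall i, idempotent_elt (e i).
Hypothesis e_orth : forall i j, i != j -> e i * e j = 0.

Let sum_e (S : pred nat) n := \sum_(i < n | S i) e i.

Let mul_sum_e S n i : e i * sum_e S n = if S i && (i < n)%N then e i else 0.
Proof.
rewrite /sum_e mulr_sumr; case: ifP => [/andP[Si i_lt]|Si].
  rewrite (bigD1 (Ordinal i_lt)) //= ee big1 ?addr0 // => j /andP[_ ji].
  by apply: e_orth; rewrite eq_sym.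
apply: big1 => j Sj; apply: e_orth; apply/eqP => ij.
by rewrite ij Sj ltn_ord in Si.
Qed.

Let sum_e_compl S n : sum_e S n * sum_e (predC S) n = 0.
Proof.
rewrite {1}/sum_e mulr_suml big1 // => i Si.
by rewrite mul_sum_e /= Si.
Qed.

(** Lets the later entry of the chain itself serve as the transition factor. *)
Let compl_sum_eM S m n : (m <= n)%N ->
  (1 - sum_e S m) * (1 - sum_e S n) = 1 - sum_e S n.
Proof.
move=> mn; rewrite mulrBl mul1r mulrBr mulr1.
suff -> : sum_e S m * sum_e S n = sum_e S m by rewrite subrr subr0.
rewrite {1 3}/sum_e mulr_suml; apply: eq_bigr => i Si.
by rewrite mul_sum_e Si (leq_trans (ltn_ord i) mn).
Qed.

Lemma orthogonal_idempotent_select (S : pred nat) :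
  exists c, idempotent_elt c /\
    forall i, e i * c = if S i then 0 else e i.
Proof.
pose a n := 1 - sum_e S n; pose b n := 1 - sum_e (predC S) n.
have [n|i j ij|i k j ik kj|c [cc c_le]] :=
  chain_idempotent a b (fun _ => a) (fun _ => b).
- apply/right_coprimeP; exists (sum_e (predC S) n), 1.
  by rewrite mulrBl mul1r sum_e_compl subr0 mulr1 addrC subrK.
- by rewrite /a /b !compl_sum_eM ?(ltnW ij).
- by rewrite /a /b !compl_sum_eM ?(ltnW kj).
(* [i.+1] is the first length at which [e i] can occur in a sum; there [e i] kills [a i.+1] if [S i]
   holds, and [b i.+1] otherwise. *)
exists c; split=> // i; have [[u _ uE] [v _ vE]] := c_le i.+1.
case: ifPn => Si.
  by rewrite -uE mulrA mulrBr mulr1 mul_sum_e Si ltnSn subrr mul0r.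
apply/eqP; rewrite eq_sym -subr_eq0 -[X in X - _]mulr1 -mulrBr -vE.
by rewrite mulrA mulrBr mulr1 mul_sum_e /= Si ltnSn subrr mul0r.
Qed.

Lemma orthogonal_idempotents_uncountable :
  (forall i, e i != 0) -> ~ countable [set c : R | idempotent_elt c].
Proof.
move=> e_neq0 /countable_injP[f f_inj].
(* Diagonal set: the idempotent [c] selected by [S] contradicts its own membership test at the index
   [f c]. *)
pose S i := `[< exists c, [/\ idempotent_elt c, f c = i & e i * c = e i] >].
have [c [cc cE]] := orthogonal_idempotent_select S.
have := cE (f c); case: ifPn => [/asboolP[c' [c'c' fc' ec']]|/asboolPn nSc ec].
  have cE' : c' = c by apply: f_inj; rewrite ?inE.
  rewrite {}cE' in ec' => ec0.
  by have := e_neq0 (f c); rewrite -ec' ec0 eqxx.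
by case: nSc; exists c.
Qed.

End OrthogonalSequence.

(** * Countably many idempotents and semisimplicity modulo the radical *)

Hypothesis Ridem : countable [set e : R | idempotent_elt e].

(** Otherwise every idempotent of [I] could be enlarged by a nonzero orthogonal one, and iterating
    from 0 would give an infinite orthogonal sequence. *)
Lemma maximal_idempotent_in (I : set R) : right_ideal I ->
  exists e, [/\ idempotent_elt e, I e &
    forall f, idempotent_elt f -> I f -> e * f = 0 -> f = 0].
Proof.
move=> [I0 IB IM]; apply: contrapT => no_max.
have ID u v : I u -> I v -> I (u + v).
  by move=> Iu Iv; rewrite -[v]opprK; apply: (IB) => //; rewrite -[- v]sub0r; apply: IB.
pose T := {e : R | idempotent_elt e /\ I e}.
have next (t : T) : {f : R |
    [/\ idempotent_elt f, I f, f != 0, sval t * f = 0 & f * sval t = 0]}.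
  apply: cid; case: t => e [ee Ie] /=; apply: contrapT => no_f; apply: no_max.
  exists e; split=> // f ff If ef0; apply: contrapT => /eqP f_neq0; apply: no_f.
  (* Passing to [f * (1 - e)] makes the orthogonality to [e] two-sided; this identity keeps it
     idempotent and nonzero. *)
  have f'f : f * (1 - e) * f = f by rewrite -mulrA mulrBl mul1r ef0 subr0.
  exists (f * (1 - e)); split.
  - by rewrite /idempotent_elt mulrA f'f.
  - exact: IM.
  - by apply: contra_neq f_neq0 => f'0; rewrite -f'f f'0 mul0r.
  - by rewrite mulrA ef0 mul0r.
  - by rewrite -mulrA mulrBl mul1r ee subrr mulr0.
have stepP (t : T) : idempotent_elt (sval t + sval (next t)) /\
    I (sval t + sval (next t)).
  case: (next t) => f /= [ff If _ tf ft]; case: t tf ft => e [ee Ie] /= ef fe.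
  split; last exact: ID.
  by rewrite /idempotent_elt mulrDl !mulrDr ee ff ef fe addr0 add0r.
pose t n := iter n (fun t : T => exist _ _ (stepP t) : T)
  (exist _ 0 (conj (mulr0 0) I0)).
pose s n := sval (t n); pose e n := sval (next (t n)).
have sS n : s n.+1 = s n + e n by [].
have ss n : s n * s n = s n by rewrite /s; case: (t n) => ? [].
have eP n : [/\ idempotent_elt (e n), e n != 0, s n * e n = 0 & e n * s n = 0].
  by rewrite /e /s; case: (next (t n)) => f [].
(* Each [e i] is absorbed by the later partial sums [s j], and [e j] is orthogonal to [s j], hence
   to [e i]. *)
have es i j : (i < j)%N -> e i * s j = e i /\ s j * e i = e i.
  have [ei _ se es] := eP i; elim: j => // j IHj; rewrite ltnS leq_eqVlt.
  case/orP=> [/eqP <-|/IHj[IH1 IH2]].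
    by rewrite sS mulrDr mulrDl es se ei !add0r.
  have [_ _ sej esj] := eP j.
  have ij0 : e i * e j = 0 by rewrite -IH1 -mulrA sej mulr0.
  have ji0 : e j * e i = 0 by rewrite -IH2 mulrA esj mul0r.
  by rewrite sS mulrDr mulrDl IH1 IH2 ij0 ji0 !addr0.
apply: (orthogonal_idempotents_uncountable e) Ridem.
- by move=> i; have [] := eP i.
- move=> i j; rewrite neq_ltn => /orP[ij|ji].
    have [_ _ sej _] := eP j; have [<- _] := es _ _ ij.
    by rewrite -mulrA sej mulr0.
  have [_ _ _ esi] := eP i; have [_ <-] := es _ _ ji.
  by rewrite mulrA esi mul0r.
- by move=> i; have [] := eP i.
Qed.

Lemma jacobson_quot_semisimple : semisimple_ring (jacobson_quot R).
Proof.
move=> I' [I'0 I'B I'M]; pose p : R -> _ := @jacobson_proj R.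
pose I := [set x : R | I' (p x)].
have II : right_ideal I.
  split=> [|x y|x r]; rewrite /I /= /p ?rmorph0 ?rmorphB ?rmorphM //.
  - exact: I'B.
  - exact: I'M.
have [_ IB IM] := II.
have [e [ee Ie e_max]] := maximal_idempotent_in I II.
exists (rprincipal (p (1 - e))); split.
- split=> [|_ _ [x _ <-] [y _ <-]|_ r [x _ <-]].
  + by exists 0; rewrite ?mulr0.
  + by exists (x - y); rewrite ?mulrBr.
  + by exists (x * r); rewrite ?mulrA.
- apply/seteqP; split=> // u _; exists (p e * u); first exact: I'M.
  exists (p (1 - e) * u); first by exists u.
  by rewrite -mulrDl -rmorphD addrC subrK rmorph1 mul1r.
apply/seteqP; split=> [u [I'u [v _ vE]]|u ->]; last first.
  by split=> //; exists 0; rewrite ?mulr0.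
have [x xu] := jacobson_proj_surj u.
(* [u] is fixed by [p (1 - e)], so it has a preimage in [(1 - e)R], which also lies in [I]; [e_max]
   leaves no nonzero idempotent in the right ideal it generates. *)
have ux : u = p ((1 - e) * x).
  rewrite /p rmorphM /= xu -vE mulrA -rmorphM; congr (jacobson_proj _ * _).
  by rewrite mulrBr mulr1 mulrBl mul1r ee subrr subr0.
rewrite ux /=; apply/eqP; rewrite jacobson_proj_eq0.
apply: no_idempotent_jacobson => f ff [r _ fE]; apply: e_max => //.
  by rewrite -fE; apply: IM; rewrite /I /= -ux.
by rewrite -fE !mulrA mulrBr mulr1 ee subrr !mul0r.
Qed.

End StronglyExchange.

Theorem theorem4p11 (R : pzRingType)
    (Rexchange : right_strongly_exchange R)
    (Ridem : countable [set e : R | idempotent_elt e]) :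
  semiperfect R.
Proof.
split; first exact: jacobson_quot_semisimple.
exact: idempotents_lift.
Qed.
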